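(* Let $-1<c<0$, $-1<a<1$, and $b\in\mathbb{R}$. Let $t\in\mathbb{C}$ satisfy both $|t|<1$ and $|t|(1-|t|)^c<\dfrac{|c|^c}{(c+1)^{c+1}}$. Then $$\sum_{n=1}^\infty \frac{t^n}{n+a}\prod_{k=1}^{n-1}\frac{k-b+a(c+1)}{k+a}=\sum_{n=1}^\infty t^n(1-t)^{b+nc}\,\frac{(1+b+nc)_{n-1}}{(n-1)!\,(n+a)}.$$
   Context: $(x)_n=x(x+1)\cdots(x+n-1)$ (with $(x)_0=1$) is the Pochhammer symbol (rising factorial), equal to $\Gamma(x+n)/\Gamma(x)$ where the latter is defined. Complex powers $(1-t)^{s}$ are taken with the principal branch of the logarithm. Empty products equal $1$. *)

(* Defs.v *)
From Stdlib Require Export Arith Reals List.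
From Coquelicot Require Export Coquelicot.

Open Scope R_scope.

(* The product of u k over m <= k < n; it is 1 when n <= m. *)
Definition Rprod (u : nat -> R) (m n : nat) : R :=
  fold_right Rmult 1 (map u (seq m (n - m))).

Definition pochhammer (x : R) (n : nat) : R :=
  Rprod (fun k => x + INR k) 0 n.

(* Principal argument, with values in (-PI, PI] for z <> 0. *)
Definition Carg (z : C) : R :=
  if Rle_dec 0 (Im z) then acos (Re z / Cmod z) else - acos (Re z / Cmod z).

Definition Cln (z : C) : C := (ln (Cmod z), Carg z).

Definition Cexp (z : C) : C :=
  (exp (Re z) * cos (Im z), exp (Re z) * sin (Im z)).

(* Principal power; only meaningful for z <> 0, since [Cln 0] is a junk value. *)
Definition Cpower (z s : C) : C := Cexp (s * Cln z)%C.

(* u 1 + u 2 + u 3 + ... converges in C to l. *)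
Definition is_Cseries_from_1 (u : nat -> C) (l : C) : Prop :=
  @is_series C_AbsRing C_NormedModule (fun m => u (S m)) l.

(* Main.v *)
Require Import Defs.
From Stdlib Require Import Reals List Arith ZArith Lra Lia.
From Coquelicot Require Import Coquelicot.

Open Scope R_scope.

(** Each power [(1 - t)^(b + n c)] on the right is a binomial series in [t]:
    with [x_n = b + n c],
    [(1 - t)^(x_n) = sum_j (- x_n)_j / j! * t^j] ([binomial_series]).
    Substituting this and collecting the terms in [t^N] gives the left-hand
    series, provided that the coefficients agree and that the double series
    may be summed along its diagonals.

    Coefficients ([coefficient_identity]).  The product
    [(1 + x_n)_(n-1) * (- x_n)_(N-n)] is, up to the sign [(-1)^(N-n)], a falling
    factorial of fixed length [N - 1] starting at [b - 1 + n (c + 1)], hence a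
    polynomial [P(n)] of degree less than [N].  The coefficient of [t^N] is
    thus [sum_n (-1)^(N-n) P(n) / ((n-1)! (N-n)! (n+a))], a finite difference
    of order [N - 1] of [P(y) / (y + a)].  Such a difference sees only the
    polar part [P(-a) / (y + a)], and [P(-a)] is up to sign the product
    of the numerators on the left.

    Summation along diagonals.  As [x_n <= 0] for large [n], all the
    coefficients [(- x_n)_j / j!] are then nonnegative, so that the sum over
    [j] of the absolute values of the terms is obtained by replacing [t] by
    [|t|].  It remains to see that
    [sum_n |(1 + x_n)_(n-1)| / (n-1)! * th^n] converges, where
    [th = |t| (1 - |t|)^c] ([ex_series_pochhammer]).  Put [p = - c] and
    [d_n = - x_n].  Comparing the factors [i - d_n], [0 < i < n], with integers
    bounds [|(1 + x_n)_(n-1)| / (n-1)!] by the inverse of the binomial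
    coefficient [(n-1 choose m)], where [m] is the integral part of [d_n].  In
    the binomial distribution of parameter [p] this [m] is within a bounded
    distance of the mean, so the inverse of [(n-1 choose m) p^m (1-p)^(n-1-m)]
    has consecutive ratios tending to 1 and does not affect the exponential
    rate, which is that of [p^m (1-p)^(n-1-m)], namely [p^p (1-p)^(1-p)].  The
    hypothesis on [t] says exactly that [th * p^p (1-p)^(1-p) < 1].  Dominated
    convergence for series ([tannery]) then concludes. *)

(** * Rising and falling factorials *)

Lemma fact_S_INR (n : nat) : INR (fact (S n)) = (INR n + 1) * INR (fact n).
Proof. rewrite <- S_INR, <- mult_INR. reflexivity. Qed.

Lemma Rprod_S (u : nat -> R) (m n : nat) :
  (m <= n)%nat -> Rprod u m (S n) = Rprod u m n * u n.
Proof.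
  intros H. unfold Rprod.
  replace (S n - m)%nat with (S (n - m)) by lia.
  rewrite seq_S, map_app. replace (m + (n - m))%nat with n by lia.
  generalize (map u (seq m (n - m))); intros l.
  induction l as [|x l IH]; simpl in *; [ring | rewrite IH; ring].
Qed.

Lemma Rprod_shift (u : nat -> R) (m n : nat) :
  Rprod u (S m) (S n) = Rprod (fun k => u (S k)) m n.
Proof.
  unfold Rprod. simpl. now rewrite <- seq_shift, map_map.
Qed.

Lemma Rprod_ext (u v : nat -> R) (m n : nat) :
  (forall k, u k = v k) -> Rprod u m n = Rprod v m n.
Proof. intros H. unfold Rprod. f_equal. now apply map_ext. Qed.

Lemma Rprod_pos (u : nat -> R) (n : nat) :
  (forall k, 0 < u k) -> 0 < Rprod u 0 n.
Proof.
  intros H. induction n as [|n IH]; [unfold Rprod; simpl; lra|].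
  rewrite Rprod_S by lia. now apply Rmult_lt_0_compat.
Qed.

Lemma pochhammer_S (x : R) (n : nat) :
  pochhammer x (S n) = pochhammer x n * (x + INR n).
Proof. unfold pochhammer. now rewrite Rprod_S by lia. Qed.

Lemma pochhammer_0 (x : R) : pochhammer x 0 = 1.
Proof. reflexivity. Qed.

Lemma pochhammer_S_l (x : R) (n : nat) :
  pochhammer x (S n) = x * pochhammer (x + 1) n.
Proof.
  induction n as [|n IH].
  - rewrite pochhammer_S, !pochhammer_0. simpl. ring.
  - rewrite pochhammer_S, IH, pochhammer_S, S_INR. ring.
Qed.

Lemma Rprod_div (u v : nat -> R) (m n : nat) :
  Rprod (fun k => u k / v k) m n = Rprod u m n / Rprod v m n.
Proof.
  unfold Rprod. induction (seq m (n - m)) as [|k l IH]; simpl.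
  - field.
  - rewrite IH. unfold Rdiv. rewrite Rinv_mult. ring.
Qed.

Definition falling (z : R) (m : nat) : R := Rprod (fun l => z - INR l) 0 m.

Lemma falling_0 (z : R) : falling z 0 = 1.
Proof. reflexivity. Qed.

Lemma falling_S (z : R) (m : nat) : falling z (S m) = falling z m * (z - INR m).
Proof. unfold falling. now rewrite Rprod_S by lia. Qed.

Lemma falling_S_l (z : R) (m : nat) :
  falling (z + 1) (S m) = (z + 1) * falling z m.
Proof.
  induction m as [|m IH].
  - rewrite falling_S, !falling_0. simpl. ring.
  - rewrite falling_S, IH, falling_S, S_INR. ring.
Qed.

Lemma falling_opp (z : R) (m : nat) :
  falling (- z) m = (-1) ^ m * pochhammer z m.
Proof.
  induction m as [|m IH]; [rewrite falling_0, pochhammer_0; simpl; ring|].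
  rewrite falling_S, pochhammer_S, IH. simpl. ring.
Qed.

(** The two rising factorials run over adjacent blocks of one arithmetic
    progression, upwards and downwards from [x].  For [x = b + n c] the top
    [x + i] is affine in [i] while the length [i + j] stays constant along a
    diagonal, which is what makes the diagonal sums finite differences. *)
Lemma pochhammer_mul_falling (x : R) (i j : nat) :
  pochhammer (1 + x) i * pochhammer (- x) j
  = (-1) ^ j * falling (x + INR i) (i + j).
Proof.
  induction i as [|i IH].
  - rewrite pochhammer_0. rewrite Nat.add_0_l. simpl INR. rewrite Rplus_0_r.
    replace (falling x j) with (falling (- - x) j) by (f_equal; ring).
    rewrite falling_opp.
    rewrite <- Rmult_assoc, <- Rpow_mult_distr.
    replace (-1 * -1) with 1 by ring. rewrite pow1. ring.
  - rewrite S_INR, <- Rplus_assoc. rewrite Nat.add_succ_l, falling_S_l.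
    transitivity ((x + INR i + 1) * (pochhammer (1 + x) i * pochhammer (- x) j)).
    + rewrite pochhammer_S. ring.
    + rewrite IH. ring.
Qed.

(** * Finite differences and the coefficient identity *)

Fixpoint fdiff (k : nat) (g : R -> R) (x : R) : R :=
  match k with
  | O => g x
  | S k => fdiff k g (x + 1) - fdiff k g x
  end.

Lemma fdiff_ext (k : nat) (g h : R -> R) (x : R) :
  (forall i : nat, g (x + INR i) = h (x + INR i)) -> fdiff k g x = fdiff k h x.
Proof.
  revert x. induction k as [|k IH]; intros x H; simpl.
  - specialize (H O). simpl in H. now rewrite Rplus_0_r in H.
  - rewrite (IH x H), (IH (x + 1)); [reflexivity|].
    intros i. specialize (H (S i)). rewrite S_INR in H.
    now replace (x + 1 + INR i) with (x + (INR i + 1)) by ring.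
Qed.

Lemma fdiff_lin (k : nat) (r s : R) (g h : R -> R) (x : R) :
  fdiff k (fun y => r * g y + s * h y) x = r * fdiff k g x + s * fdiff k h x.
Proof.
  revert x. induction k as [|k IH]; intros x; simpl; [ring|].
  rewrite !IH. ring.
Qed.

(** Leibniz rule; the differences of an affine factor vanish beyond the first. *)
Lemma fdiff_mul_affine (k : nat) (r s : R) (g : R -> R) (x : R) :
  fdiff (S k) (fun y => (r + s * y) * g y) x
  = (r + s * x) * fdiff (S k) g x + INR (S k) * s * fdiff k g (x + 1).
Proof.
  revert x. induction k as [|k IH]; intros x.
  - simpl. ring.
  - change (fdiff (S (S k)) (fun y => (r + s * y) * g y) x)
      with (fdiff (S k) (fun y => (r + s * y) * g y) (x + 1)
            - fdiff (S k) (fun y => (r + s * y) * g y) x).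
    rewrite !IH.
    change (fdiff (S (S k)) g x) with (fdiff (S k) g (x + 1) - fdiff (S k) g x).
    rewrite (S_INR (S k)).
    change (fdiff (S k) g (x + 1)) with (fdiff k g (x + 1 + 1) - fdiff k g (x + 1)).
    ring.
Qed.

(** Divided by [k!] the binomial coefficients of the usual expansion split
    into the two inverse factorials that occur in the diagonal sums. *)
Lemma fdiff_expand (k : nat) (g : R -> R) (x : R) :
  fdiff k g x / INR (fact k)
  = sum_f_R0 (fun i => (-1) ^ (k - i) * g (x + INR i)
                       / (INR (fact i) * INR (fact (k - i)))) k.
Proof.
  revert x. induction k as [|k IH]; intros x.
  - simpl. rewrite Rplus_0_r. field.
  - assert (HF : INR (fact (S k)) = INR (S k) * INR (fact k)).
    { rewrite <- mult_INR. reflexivity. }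
    assert (Hf := INR_fact_lt_0). assert (HS : 0 < INR (S k)) by (apply lt_0_INR; lia).
    simpl fdiff. rewrite HF.
    replace ((fdiff k g (x + 1) - fdiff k g x) / (INR (S k) * INR (fact k)))
      with ((fdiff k g (x + 1) / INR (fact k) - fdiff k g x / INR (fact k)) / INR (S k))
      by (field; split; [specialize (Hf k)|]; lra).
    rewrite !IH. clear IH.
    (* With T i the term of order k + 1, the two sums of order k are the parts of
       (k + 1) * T i = i * T i + (k + 1 - i) * T i. *)
    set (T := fun i => (-1) ^ (S k - i) * g (x + INR i)
                       / (INR (fact i) * INR (fact (S k - i)))).
    assert (E1 : sum_f_R0 (fun i => (-1) ^ (k - i) * g (x + 1 + INR i)
                       / (INR (fact i) * INR (fact (k - i)))) k
                 = sum_f_R0 (fun i => INR i * T i) (S k)).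
    { rewrite (decomp_sum _ (S k)) by lia. simpl (INR 0). rewrite Rmult_0_l, Rplus_0_l.
      simpl pred. apply sum_eq. intros i Hi. unfold T.
      replace (S k - S i)%nat with (k - i)%nat by lia.
      rewrite S_INR. replace (x + (INR i + 1)) with (x + 1 + INR i) by ring.
      replace (INR (fact (S i))) with ((INR i + 1) * INR (fact i))
        by (rewrite <- S_INR, <- mult_INR; reflexivity).
      field. repeat split; try apply INR_fact_neq_0.
      pose proof (pos_INR i); lra. }
    assert (E2 : sum_f_R0 (fun i => (-1) ^ (k - i) * g (x + INR i)
                       / (INR (fact i) * INR (fact (k - i)))) k
                 = - sum_f_R0 (fun i => INR (S k - i) * T i) (S k)).
    { rewrite tech5. rewrite Nat.sub_diag. simpl (INR 0).
      rewrite Rmult_0_l, Rplus_0_r.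
      rewrite <- (Rmult_1_l (sum_f_R0 (fun i => INR (S k - i) * T i) k)),
        Ropp_mult_distr_l, scal_sum.
      apply sum_eq. intros i Hi. unfold T.
      replace (S k - i)%nat with (S (k - i)) by lia.
      replace (INR (fact (S (k - i)))) with (INR (S (k - i)) * INR (fact (k - i)))
        by (rewrite <- mult_INR; reflexivity).
      simpl pow. field. repeat split; try apply INR_fact_neq_0.
      apply not_0_INR; lia. }
    rewrite E1, E2.
    replace (sum_f_R0 (fun i => INR i * T i) (S k)
             - - sum_f_R0 (fun i => INR (S k - i) * T i) (S k))
      with (sum_f_R0 (fun i => INR i * T i + INR (S k - i) * T i) (S k))
      by (rewrite sum_plus; ring).
    rewrite (sum_eq _ (fun i => T i * INR (S k))).
    + rewrite <- scal_sum. field. lra.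
    + intros i Hi. rewrite minus_INR by lia. ring.
Qed.

(** As a function of [y] this is a polynomial of degree at most [m]. *)
Lemma fdiff_falling (r s : R) (m k : nat) (x : R) :
  (m < k)%nat -> fdiff k (fun y => falling (r + s * y) m) x = 0.
Proof.
  revert k x. induction m as [|m IH]; intros [|k] x Hk; try lia.
  - clear Hk. revert x. induction k as [|k IHk]; intros x.
    + simpl. rewrite !falling_0. ring.
    + change (fdiff (S k) (fun y => falling (r + s * y) 0) (x + 1)
              - fdiff (S k) (fun y => falling (r + s * y) 0) x = 0).
      rewrite !IHk. ring.
  - rewrite (fdiff_ext _ _ (fun y => (r - INR m + s * y) * falling (r + s * y) m))
      by (intros; rewrite falling_S; ring).
    rewrite fdiff_mul_affine, !IH by lia. ring.
Qed.

Lemma fdiff_inv (k : nat) (e x : R) :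
  0 < x + e ->
  fdiff k (fun y => / (y + e)) x
  = (-1) ^ k * INR (fact k) / pochhammer (x + e) (S k).
Proof.
  revert x. induction k as [|k IH]; intros x Hx.
  - rewrite pochhammer_S, pochhammer_0. simpl. field. lra.
  - simpl fdiff. rewrite !IH by lra.
    assert (Hp : 0 < pochhammer (x + e + 1) k).
    { apply Rprod_pos. intros l. pose proof (pos_INR l). lra. }
    pose proof (pos_INR k) as Hk.
    replace (x + 1 + e) with (x + e + 1) by ring.
    rewrite (pochhammer_S_l (x + e) (S k)), (pochhammer_S_l (x + e) k).
    rewrite !pochhammer_S.
    replace (INR (fact (S k))) with ((INR k + 1) * INR (fact k))
      by (rewrite <- S_INR, <- mult_INR; reflexivity).
    simpl pow. field. repeat split; lra.
Qed.

(** Modulo [y + e] the polynomial in the numerator reduces to its value at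
    [y = - e]; the quotient has degree less than [m <= k], so that its
    differences of order [k] vanish. *)
Lemma fdiff_falling_div (r s e : R) (m k : nat) (x : R) :
  (m <= k)%nat -> 0 < x + e ->
  fdiff k (fun y => falling (r + s * y) m / (y + e)) x
  = falling (r - s * e) m * ((-1) ^ k * INR (fact k) / pochhammer (x + e) (S k)).
Proof.
  intros Hm Hx. induction m as [|m IH].
  - rewrite <- fdiff_inv, falling_0, Rmult_1_l by lra.
    apply fdiff_ext. intros i. rewrite falling_0. unfold Rdiv. ring.
  - rewrite (fdiff_ext _ _ (fun y => s * falling (r + s * y) m
               + (r - INR m - s * e) * (falling (r + s * y) m / (y + e)))).
    + rewrite fdiff_lin, fdiff_falling, IH, falling_S by lia. ring.
    + intros i. rewrite falling_S. pose proof (pos_INR i). field. lra.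
Qed.

Definition binom_coef (s : R) (j : nat) : R := pochhammer (- s) j / INR (fact j).

(** Equality of the coefficients of [t^(k+1)]; the summation index is
    [i = n - 1], so that the simple pole [n = - a] sits at [i = - (1 + a)]. *)
Lemma coefficient_identity (a b c : R) (k : nat) :
  -1 < a ->
  sum_f_R0 (fun i =>
      pochhammer (1 + b + INR (S i) * c) i / (INR (fact i) * (INR (S i) + a))
      * binom_coef (b + INR (S i) * c) (k - i)) k
  = / (INR (S k) + a)
    * Rprod (fun l => (INR l - b + a * (c + 1)) / (INR l + a)) 1 (S k).
Proof.
  intros Ha.
  set (g := fun y => falling (b + c + (c + 1) * y) k / (y + (1 + a))).
  rewrite (sum_eq _ (fun i => (-1) ^ (k - i) * g (0 + INR i)
                       / (INR (fact i) * INR (fact (k - i))))).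
  - rewrite <- fdiff_expand. unfold g.
    rewrite fdiff_falling_div by (lia || lra).
    rewrite Rprod_shift, Rprod_div.
    replace (b + c - (c + 1) * (1 + a)) with (- (1 - b + a * (c + 1))) by ring.
    rewrite falling_opp, Rplus_0_l, pochhammer_S.
    rewrite (Rprod_ext (fun l => INR (S l) + a) (fun l => 1 + a + INR l))
      by (intros; rewrite S_INR; ring).
    rewrite (Rprod_ext (fun l => INR (S l) - b + a * (c + 1))
                       (fun l => 1 - b + a * (c + 1) + INR l))
      by (intros; rewrite S_INR; ring).
    fold (pochhammer (1 + a) k). fold (pochhammer (1 - b + a * (c + 1)) k).
    assert (Hp : 0 < pochhammer (1 + a) k).
    { apply Rprod_pos. intros l. pose proof (pos_INR l). lra. }
    assert (Hs : (-1) ^ k * (-1) ^ k = 1).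
    { rewrite <- Rpow_mult_distr. replace (-1 * -1) with 1 by ring. apply pow1. }
    rewrite S_INR. pose proof (pos_INR k).
    transitivity ((-1) ^ k * (-1) ^ k * pochhammer (1 - b + a * (c + 1)) k
                  / (pochhammer (1 + a) k * (1 + a + INR k))).
    + field. repeat split; try lra. apply INR_fact_neq_0.
    + rewrite Hs. field. lra.
  - intros i Hi. unfold binom_coef, g.
    replace (1 + b + INR (S i) * c) with (1 + (b + INR (S i) * c)) by ring.
    pose proof (pos_INR i).
    transitivity (pochhammer (1 + (b + INR (S i) * c)) i
                  * pochhammer (- (b + INR (S i) * c)) (k - i)
                  / (INR (fact i) * INR (fact (k - i)) * (INR (S i) + a))).
    + field. rewrite S_INR. repeat split; try apply INR_fact_neq_0. lra.
    + rewrite pochhammer_mul_falling. replace (i + (k - i))%nat with k by lia.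
      rewrite S_INR, Rplus_0_l.
      replace (b + (INR i + 1) * c + INR i) with (b + c + (c + 1) * INR i) by ring.
      field. repeat split; try apply INR_fact_neq_0; lra.
Qed.

(** * Dominated convergence for series, and sums over a triangle *)

Lemma is_lim_sum_n {K : AbsRing} {V : NormedModule K}
    (u : nat -> nat -> V) (A : nat -> V) (M : nat) :
  (forall i, filterlim (u i) eventually (locally (A i))) ->
  filterlim (fun N => sum_n (fun i => u i N) M) eventually (locally (sum_n A M)).
Proof.
  intros H. induction M as [|M IH].
  - rewrite sum_O. apply (filterlim_ext (u O)); [|apply H].
    intros N. now rewrite sum_O.
  - rewrite sum_Sn.
    apply (filterlim_ext (fun N => plus (sum_n (fun i => u i N) M) (u (S M) N))).
    { intros N. now rewrite sum_Sn. }
    eapply filterlim_comp_2; [exact IH | apply H | apply filterlim_plus].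
Qed.

Lemma minus_plus_split {G : AbelianGroup} (v w x y : G) :
  minus (plus v w) x = plus (minus v y) (plus (minus y x) w).
Proof.
  unfold minus. rewrite <- !plus_assoc. f_equal.
  rewrite (plus_assoc (opp y)), plus_opp_l, plus_zero_l. apply plus_comm.
Qed.

(** Both the summands and the number of them depend on [N].  Up to a fixed
    [M] the sum converges by [is_lim_sum_n]; beyond it the tail of [k] bounds
    what is left, uniformly in [N]. *)
Lemma tannery {K : AbsRing} {V : CompleteNormedModule K}
    (u : nat -> nat -> V) (A : nat -> V) (k : nat -> R) :
  (forall i N, norm (u i N) <= k i) ->
  (forall i, filterlim (u i) eventually (locally (A i))) ->
  ex_series k ->
  exists S, is_series A S /\
    filterlim (fun N => sum_n (fun i => u i N) N) eventually (locally S).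
Proof.
  intros Hb Hl Hk.
  assert (HA : forall i, norm (A i) <= k i).
  { intros i.
    assert (H1 : filterlim (fun N => norm (u i N)) eventually (locally (norm (A i)))).
    { exact (filterlim_comp _ _ _ _ _ _ _ _ (Hl i) (@filterlim_norm K V (A i))). }
    apply (is_lim_seq_le (fun N => norm (u i N)) (fun _ => k i) (norm (A i)) (k i)).
    - intros N. apply Hb.
    - exact H1.
    - apply is_lim_seq_const. }
  destruct (ex_series_le A k HA Hk) as [S HS].
  exists S. split; [exact HS|].
  apply (filterlim_locally_ball_norm (F := eventually)).
  intros eps.
  assert (He : 0 < eps / 4) by (destruct eps; simpl; lra).
  destruct (Cauchy_ex_series k Hk (mkposreal _ He)) as [M1 HM1]. simpl in HM1.
  destruct (proj1 (filterlim_locally_ball_norm (F := eventually) (sum_n A) S) HS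
              (mkposreal _ He)) as [M2 HM2]. simpl in HM2.
  set (M := max M1 M2).
  destruct (proj1 (filterlim_locally_ball_norm (F := eventually) _ _)
              (is_lim_sum_n u A M Hl) (mkposreal _ He)) as [N1 HN1]. simpl in HN1.
  exists (max N1 (M + 1)). intros N HN. unfold ball_norm in *.
  assert (HMN : (M < N)%nat) by lia.
  specialize (HM2 M ltac:(lia)). specialize (HN1 N ltac:(lia)).
  specialize (HM1 (Datatypes.S M) N ltac:(lia) ltac:(lia)).
  set (v := sum_n (fun i => u i N) M) in *.
  assert (Hsplit : sum_n (fun i => u i N) N
            = plus v (sum_n_m (fun i => u i N) (Datatypes.S M) N)).
  { unfold v, sum_n. apply sum_n_m_Chasles; lia. }
  set (w := sum_n_m (fun i => u i N) (Datatypes.S M) N) in *.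
  assert (Hw : norm w <= eps / 4).
  { eapply Rle_trans; [exact (@norm_sum_n_m K V (fun i => u i N) (Datatypes.S M) N)|].
    apply Rle_trans with (sum_n_m k (Datatypes.S M) N).
    - apply sum_n_m_le. intros i. apply Hb.
    - eapply Rle_trans; [|left; exact HM1]. apply Rle_abs. }
  rewrite Hsplit.
  set (x := minus v (sum_n A M)) in *. set (y := minus (sum_n A M) S) in *.
  assert (Hxyw : minus (plus v w) S = plus x (plus y w)).
  { exact (@minus_plus_split (CompleteNormedModule.AbelianGroup K V) v w S (sum_n A M)). }
  apply Rle_lt_trans with (norm x + (norm y + norm w)).
  - eapply Rle_trans; [right; exact (f_equal (@norm K V) Hxyw)|].
    eapply Rle_trans; [exact (@norm_triangle K V x (plus y w))|].
    apply Rplus_le_compat_l. exact (@norm_triangle K V y w).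
  - assert (Hx : norm x < eps / 4) by exact HN1.
    assert (Hy : norm y < eps / 4) by exact HM2.
    destruct eps; simpl in *; lra.
Qed.

Lemma sum_n_triangle {G : AbelianMonoid} (f : nat -> nat -> G) (N : nat) :
  sum_n (fun i => sum_n (f i) (N - i)) N
  = sum_n (fun k => sum_n (fun i => f i (k - i)%nat) k) N.
Proof.
  induction N as [|N IH].
  - rewrite !sum_O. reflexivity.
  - rewrite (sum_Sn (fun k => sum_n (fun i => f i (k - i)%nat) k)), <- IH.
    rewrite (sum_Sn (fun i => f i (S N - i)%nat)), plus_assoc.
    rewrite <- sum_n_plus.
    rewrite (sum_Sn (fun i => sum_n (f i) (S N - i))).
    f_equal.
    + apply sum_n_ext_loc. intros i Hi.
      replace (S N - i)%nat with (S (N - i)) by lia. apply sum_Sn.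
    + rewrite Nat.sub_diag. apply sum_O.
Qed.

(** * Series of complex numbers *)

Lemma sum_n_components (u : nat -> C) (N : nat) :
  sum_n u N = (sum_n (fun n => Re (u n)) N, sum_n (fun n => Im (u n)) N).
Proof.
  induction N as [|N IH].
  - rewrite !sum_O. apply surjective_pairing.
  - rewrite !sum_Sn, IH. reflexivity.
Qed.

Lemma is_series_of_components (u : nat -> C) (l : C) :
  is_series (fun n => Re (u n)) (Re l) -> is_series (fun n => Im (u n)) (Im l) ->
  @is_series C_AbsRing C_NormedModule u l.
Proof.
  intros Hr Hi. unfold is_series.
  apply (filterlim_ext (fun N => (sum_n (fun n => Re (u n)) N, sum_n (fun n => Im (u n)) N))).
  { intros N. symmetry. apply sum_n_components. }
  apply (filterlim_locally (U := C_UniformSpace)). intros eps.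
  pose proof (proj1 (filterlim_locally _ _) Hr eps) as H1.
  pose proof (proj1 (filterlim_locally _ _) Hi eps) as H2.
  generalize (filter_and _ _ H1 H2). apply filter_imp. intros N [HN1 HN2].
  split; assumption.
Qed.

Lemma is_series_Re (u : nat -> C) (l : C) :
  @is_series C_AbsRing C_NormedModule u l -> is_series (fun n => Re (u n)) (Re l).
Proof.
  intros H. unfold is_series. apply filterlim_locally. intros eps.
  pose proof (proj1 (filterlim_locally (U := C_UniformSpace) _ _) H eps) as H1.
  revert H1. apply filter_imp. intros N HN. rewrite sum_n_components in HN. apply HN.
Qed.

(** * Principal powers and the binomial series *)

(** On the right half-plane, which contains [1 - t], the principal argument
    is a smooth expression, to be differentiated
    along a segment. *)
Lemma Carg_atan (z : C) : 0 < Re z -> Carg z = atan (Im z / Re z).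
Proof.
  intros Hx. destruct z as [x y]. unfold Carg, Cmod. simpl in *.
  set (D := x * (x * 1) + y * (y * 1)).
  assert (HD : 0 < D) by (unfold D; nra).
  pose proof (sqrt_lt_R0 _ HD) as Hs.
  assert (Hxs : 0 < x / sqrt D) by now apply Rdiv_lt_0_compat.
  assert (E : acos (x / sqrt D) = atan (Rabs y / x)).
  { rewrite acos_atan by exact Hxs. f_equal.
    replace (1 - (x / sqrt D)²) with (Rsqr (y / sqrt D)).
    - rewrite sqrt_Rsqr_abs, Rabs_div by lra. rewrite (Rabs_pos_eq (sqrt D)) by lra.
      field. lra.
    - assert (HE : sqrt D * sqrt D = D) by (apply sqrt_sqrt; lra).
      unfold Rsqr. apply (Rmult_eq_reg_r (sqrt D * sqrt D)); [|nra].
      transitivity (y * y); [field; lra|].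
      transitivity (sqrt D * sqrt D - x * x); [rewrite HE; unfold D; ring|field; lra]. }
  rewrite E. destruct (Rle_dec 0 y) as [Hy|Hy].
  - now rewrite Rabs_pos_eq.
  - rewrite <- atan_opp. f_equal. rewrite Rabs_left by lra. field. lra.
Qed.

Lemma Cpower_components (x y s : R) :
  0 < x ->
  Cpower (x, y) (RtoC s)
  = (exp (s * (ln (x ^ 2 + y ^ 2) / 2)) * cos (s * atan (y / x)),
     exp (s * (ln (x ^ 2 + y ^ 2) / 2)) * sin (s * atan (y / x))).
Proof.
  intros Hx. unfold Cpower, Cln, Cexp. rewrite Carg_atan by exact Hx.
  assert (HD : 0 < x ^ 2 + y ^ 2) by nra.
  assert (E : ln (Cmod (x, y)) = ln (x ^ 2 + y ^ 2) / 2).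
  { unfold Cmod. cbn [fst snd].
    rewrite <- (sqrt_sqrt (x ^ 2 + y ^ 2)) at 2 by lra.
    rewrite ln_mult by (apply sqrt_lt_R0; exact HD). field. }
  rewrite E. unfold RtoC, Cmult. cbn [fst snd Re Im].
  replace (s * (ln (x ^ 2 + y ^ 2) / 2) - 0 * atan (y / x))
    with (s * (ln (x ^ 2 + y ^ 2) / 2)) by ring.
  replace (s * atan (y / x) + 0 * (ln (x ^ 2 + y ^ 2) / 2))
    with (s * atan (y / x)) by ring.
  reflexivity.
Qed.

(** Along the segment [u |-> 1 - u t] with [t = p + i q], a function
    [F = f + i g] with [F(0) = 1] and [(1 - u t) F' = - s t F] is
    [(1 - u t)^s].  The hypotheses are the real and imaginary parts of the
    equation, written as [F' = u t F' - s t F].  The reason is that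
    [F * (1 - u t)^(- s)] has derivative zero; its modulus factor is [rho] and
    its argument is [th]. *)
Lemma Cpower_of_ode (p q s : R) (f g f1 g1 : R -> R) :
  p ^ 2 + q ^ 2 < 1 ->
  f 0 = 1 -> g 0 = 0 ->
  (forall u, 0 <= u <= 1 -> is_derive f u (f1 u)) ->
  (forall u, 0 <= u <= 1 -> is_derive g u (g1 u)) ->
  (forall u, 0 <= u <= 1 ->
     f1 u = u * (p * f1 u - q * g1 u) - s * (p * f u - q * g u)) ->
  (forall u, 0 <= u <= 1 ->
     g1 u = u * (p * g1 u + q * f1 u) - s * (p * g u + q * f u)) ->
  (f 1, g 1) = Cpower (1 - p, - q) (RtoC s).
Proof.
  intros Hpq Hf0 Hg0 Hf Hg HF HG.
  set (D := fun u => (1 - u * p) ^ 2 + (u * q) ^ 2).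
  set (rho := fun u => exp (- s * (ln (D u) / 2))).
  set (th := fun u => s * atan (u * q / (1 - u * p))).
  assert (Hp1 : forall u, 0 <= u <= 1 -> 0 < 1 - u * p).
  { intros u Hu. assert (-1 < p < 1) by nra. nra. }
  assert (HD : forall u, 0 <= u <= 1 -> 0 < D u).
  { intros u Hu. specialize (Hp1 u Hu). unfold D. nra. }
  assert (Hrho : forall u, 0 <= u <= 1 ->
            is_derive rho u (s * ((p - u * (p ^ 2 + q ^ 2)) / D u) * rho u)).
  { intros u Hu. specialize (HD u Hu). unfold rho at 1, D at 1. auto_derive.
    - exact HD.
    - match goal with |- _ * exp ?X = ?r => change (exp X) with (rho u) end.
      unfold D in *. simpl in *. field. lra. }
  assert (Hth : forall u, 0 <= u <= 1 -> is_derive th u (s * (q / D u))).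
  { intros u Hu. specialize (HD u Hu). specialize (Hp1 u Hu). unfold th, D in *.
    auto_derive.
    - lra.
    - unfold Rsqr. simpl in *. field. repeat split; lra. }
  (* Solve the equation for F', that is, divide by 1 - u t, with
     t / (1 - u t) = (p - u |t|^2 + i q) / D u. *)
  assert (Hf1 : forall u, 0 <= u <= 1 ->
            f1 u = - s * ((p - u * (p ^ 2 + q ^ 2)) / D u * f u - q / D u * g u)).
  { intros u Hu. specialize (HF u Hu). specialize (HG u Hu). specialize (HD u Hu).
    apply (Rmult_eq_reg_r (D u)); [|lra].
    transitivity (- s * ((p - u * (p ^ 2 + q ^ 2)) * f u - q * g u)); [|field; lra].
    apply Rminus_diag_uniq.
    transitivity ((1 - u * p) * (f1 u - (u * (p * f1 u - q * g1 u) - s * (p * f u - q * g u)))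
                  - u * q * (g1 u - (u * (p * g1 u + q * f1 u) - s * (p * g u + q * f u)))).
    - unfold D. ring.
    - rewrite <- HF, <- HG. ring. }
  assert (Hg1 : forall u, 0 <= u <= 1 ->
            g1 u = - s * ((p - u * (p ^ 2 + q ^ 2)) / D u * g u + q / D u * f u)).
  { intros u Hu. specialize (HF u Hu). specialize (HG u Hu). specialize (HD u Hu).
    apply (Rmult_eq_reg_r (D u)); [|lra].
    transitivity (- s * ((p - u * (p ^ 2 + q ^ 2)) * g u + q * f u)); [|field; lra].
    apply Rminus_diag_uniq.
    transitivity ((1 - u * p) * (g1 u - (u * (p * g1 u + q * f1 u) - s * (p * g u + q * f u)))
                  + u * q * (f1 u - (u * (p * f1 u - q * g1 u) - s * (p * f u - q * g u)))).
    - unfold D. ring.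
    - rewrite <- HF, <- HG. ring. }
  set (H := fun u => rho u * (f u * cos (th u) - g u * sin (th u))).
  set (J := fun u => rho u * (f u * sin (th u) + g u * cos (th u))).
  assert (HH : H 0 = H 1).
  { apply (eq_is_derive (V := R_NormedModule)); [|lra]. intros u Hu. unfold H.
    specialize (Hf u Hu). specialize (Hg u Hu). specialize (Hrho u Hu).
    specialize (Hth u Hu).
    auto_derive.
    - repeat split; try (eexists; eassumption).
    - apply is_derive_unique in Hf, Hg, Hrho, Hth.
      change (Derive (fun x : R => f x) u = f1 u) in Hf.
      change (Derive (fun x : R => g x) u = g1 u) in Hg.
      change (Derive (fun x : R => rho x) u
              = s * ((p - u * (p ^ 2 + q ^ 2)) / D u) * rho u) in Hrho.
      change (Derive (fun x : R => th x) u = s * (q / D u)) in Hth.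
      rewrite Hf, Hg, Hrho, Hth.
      rewrite Hf1, Hg1 by assumption. change zero with 0. ring. }
  assert (HJ : J 0 = J 1).
  { apply (eq_is_derive (V := R_NormedModule)); [|lra]. intros u Hu. unfold J.
    specialize (Hf u Hu). specialize (Hg u Hu). specialize (Hrho u Hu).
    specialize (Hth u Hu).
    auto_derive.
    - repeat split; try (eexists; eassumption).
    - apply is_derive_unique in Hf, Hg, Hrho, Hth.
      change (Derive (fun x : R => f x) u = f1 u) in Hf.
      change (Derive (fun x : R => g x) u = g1 u) in Hg.
      change (Derive (fun x : R => rho x) u
              = s * ((p - u * (p ^ 2 + q ^ 2)) / D u) * rho u) in Hrho.
      change (Derive (fun x : R => th x) u = s * (q / D u)) in Hth.
      rewrite Hf, Hg, Hrho, Hth.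
      rewrite Hf1, Hg1 by assumption. change zero with 0. ring. }
  assert (Hr0 : rho 0 = 1).
  { unfold rho, D. rewrite !Rmult_0_l.
    replace ((1 - 0) ^ 2 + 0 ^ 2) with 1 by ring.
    rewrite ln_1. replace (- s * (0 / 2)) with 0 by field. apply exp_0. }
  assert (Ht0 : th 0 = 0).
  { unfold th. rewrite !Rmult_0_l. unfold Rdiv. rewrite Rmult_0_l, atan_0. ring. }
  assert (HH1 : H 1 = 1).
  { rewrite <- HH. unfold H. rewrite Hr0, Ht0, Hf0, Hg0, cos_0, sin_0. ring. }
  assert (HJ1 : J 1 = 0).
  { rewrite <- HJ. unfold J. rewrite Hr0, Ht0, Hf0, Hg0, cos_0, sin_0. ring. }
  unfold H in HH1. unfold J in HJ1.
  specialize (Hp1 1 ltac:(lra)).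
  rewrite Cpower_components by lra.
  replace (s * atan (- q / (1 - p))) with (- th 1).
  2: { unfold th. rewrite !Rmult_1_l.
       replace (- q / (1 - p)) with (- (q / (1 - p))) by (field; lra).
       rewrite atan_opp. ring. }
  rewrite cos_neg, sin_neg.
  replace (exp (s * (ln ((1 - p) ^ 2 + (- q) ^ 2) / 2))) with (/ rho 1).
  2: { unfold rho, D. rewrite <- exp_Ropp. f_equal. rewrite !Rmult_1_l.
       replace ((- q) ^ 2) with (q ^ 2) by ring. ring. }
  assert (Hr1 : 0 < rho 1) by apply exp_pos.
  pose proof (sin2_cos2 (th 1)) as Hsc. unfold Rsqr in Hsc.
  apply injective_projections; simpl; apply (Rmult_eq_reg_l (rho 1)); try lra.
  - transitivity (rho 1 * f 1 * (sin (th 1) * sin (th 1) + cos (th 1) * cos (th 1)));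
      [rewrite Hsc; ring|].
    transitivity (cos (th 1) * (rho 1 * (f 1 * cos (th 1) - g 1 * sin (th 1)))
                  + sin (th 1) * (rho 1 * (f 1 * sin (th 1) + g 1 * cos (th 1))));
      [ring|].
    rewrite HH1, HJ1. field. lra.
  - transitivity (rho 1 * g 1 * (sin (th 1) * sin (th 1) + cos (th 1) * cos (th 1)));
      [rewrite Hsc; ring|].
    transitivity (cos (th 1) * (rho 1 * (f 1 * sin (th 1) + g 1 * cos (th 1)))
                  - sin (th 1) * (rho 1 * (f 1 * cos (th 1) - g 1 * sin (th 1))));
      [ring|].
    rewrite HH1, HJ1. field. lra.
Qed.

Lemma is_lim_seq_div_n (K : R) : is_lim_seq (fun n => K / INR (S n)) 0.
Proof.
  replace (Finite 0) with (Rbar_mult K 0) by (simpl; f_equal; ring).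
  apply is_lim_seq_scal_l.
  apply (is_lim_seq_incr_1 (fun n => / INR n)).
  replace (Finite 0) with (Rbar_inv p_infty) by reflexivity.
  apply is_lim_seq_inv; [apply is_lim_seq_INR | discriminate].
Qed.

(** This recurrence is the differential equation of [(1 - t)^s] read on
    coefficients. *)
Lemma binom_coef_S (s : R) (j : nat) :
  INR (S j) * binom_coef s (S j) = (INR j - s) * binom_coef s j.
Proof.
  unfold binom_coef. rewrite pochhammer_S, fact_S_INR, S_INR.
  pose proof (pos_INR j). field. split; [apply INR_fact_neq_0 | lra].
Qed.

(** Replacing [- s] by [|s| + 1] increases all the coefficients in absolute
    value and makes them positive, so that the ratio test applies even when
    [s] is a natural number and the coefficients of [s] eventually vanish. *)
Lemma ex_series_binom_abs (s x : R) :
  0 <= x < 1 -> ex_series (fun j => Rabs (binom_coef s j) * x ^ j).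
Proof.
  intros Hx.
  set (r := Rabs s + 1). assert (Hr : 0 < r) by (unfold r; pose proof (Rabs_pos s); lra).
  set (y := (x + 1) / 2).
  set (v := fun j => binom_coef (- r) j * y ^ j).
  assert (Hv : forall j, 0 < v j).
  { intros j. unfold v, binom_coef. rewrite Ropp_involutive.
    apply Rmult_lt_0_compat; [|apply pow_lt; unfold y; lra].
    apply Rdiv_lt_0_compat; [|apply INR_fact_lt_0].
    apply Rprod_pos. intros k. pose proof (pos_INR k). lra. }
  apply (ex_series_le (V := R_CompleteNormedModule) _ (fun j => Rabs (v j))).
  - intros j. change (Rabs (Rabs (binom_coef s j) * x ^ j) <= Rabs (v j)).
    rewrite (Rabs_pos_eq (v j)) by (left; apply Hv).
    rewrite Rabs_mult, Rabs_Rabsolu, (Rabs_pos_eq (x ^ j)) by (apply pow_le; lra).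
    unfold v. apply Rmult_le_compat; [apply Rabs_pos | apply pow_le; lra | |
                                      apply pow_incr; unfold y; lra].
    unfold binom_coef, Rdiv. rewrite Ropp_involutive, Rabs_mult.
    pose proof (Rinv_0_lt_compat _ (INR_fact_lt_0 j)) as Hf.
    rewrite (Rabs_pos_eq (/ _)) by lra.
    apply Rmult_le_compat_r; [lra|].
    induction j as [|j IH]; [rewrite !pochhammer_0, Rabs_R1; lra|].
    rewrite !pochhammer_S, Rabs_mult.
    apply Rmult_le_compat; try apply Rabs_pos.
    + apply IH. apply Rinv_0_lt_compat, INR_fact_lt_0.
    + eapply Rle_trans; [apply Rabs_triang|]. rewrite Rabs_Ropp.
      rewrite (Rabs_pos_eq (INR j)) by apply pos_INR. unfold r; lra.
  - apply ex_series_DAlembert with y; [unfold y; lra | intros j; apply Rgt_not_eq, Hv|].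
    apply (is_lim_seq_ext (fun j => y * (1 + (r - 1) / INR (S j)))).
    + intros j. rewrite Rabs_pos_eq by (left; now apply Rdiv_lt_0_compat).
      assert (HS : 0 < INR (S j)) by (apply lt_0_INR; lia).
      specialize (Hv j). unfold v in *.
      assert (Hy : 0 < y ^ j) by (apply pow_lt; unfold y; lra).
      assert (Hb : binom_coef (- r) j <> 0) by (intros E; rewrite E in Hv; lra).
      assert (HbS : binom_coef (- r) (S j) = (INR j + r) * binom_coef (- r) j / INR (S j)).
      { apply (Rmult_eq_reg_l (INR (S j))); [|lra]. rewrite binom_coef_S. field. lra. }
      rewrite HbS, S_INR in *. simpl pow. field. repeat split; try assumption; lra.
    + replace (Finite y) with (Rbar_mult y (1 + 0)) by (simpl; f_equal; ring).
      apply is_lim_seq_scal_l. apply is_lim_seq_plus'; [apply is_lim_seq_const|].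
      apply is_lim_seq_div_n.
Qed.

(** Used for the real and imaginary parts of the coefficients of
    [u |-> (1 - u t)^s]: the radius exceeds 1, so that [u = 1] is interior and
    no boundary argument is needed. *)
Lemma CV_radius_binom (s : R) (t : C) (A : nat -> R) :
  Cmod t < 1 ->
  (forall j, Rabs (A j) <= Rabs (binom_coef s j) * Cmod t ^ j) ->
  Rbar_lt 1 (CV_radius A).
Proof.
  intros Ht HA. set (x := Cmod t) in *. assert (Hx : 0 <= x) by apply Cmod_ge_0.
  (* Any r > 1 with x * r < 1 works. *)
  set (r := 2 / (1 + x)).
  assert (Hr : 1 < r).
  { unfold r. apply (Rmult_lt_reg_r (1 + x)); [lra|].
    replace (2 / (1 + x) * (1 + x)) with 2 by (field; lra). lra. }
  assert (Hxr : 0 <= x * r < 1).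
  { split; [apply Rmult_le_pos; lra|]. unfold r.
    apply (Rmult_lt_reg_r (1 + x)); [lra|].
    replace (x * (2 / (1 + x)) * (1 + x)) with (2 * x) by (field; lra). lra. }
  apply Rbar_lt_le_trans with (Finite r); [exact Hr|].
  apply CV_radius_bounded.
  pose proof (ex_series_binom_abs s (x * r) Hxr) as Hs.
  apply ex_series_lim_0 in Hs.
  destruct (filterlim_bounded (V := R_NormedModule) _ (ex_intro _ 0 Hs)) as [M HM].
  exists M. intros j. specialize (HM j).
  change (Rabs (Rabs (binom_coef s j) * (x * r) ^ j) <= M) in HM.
  eapply Rle_trans; [|exact HM].
  rewrite (Rabs_pos_eq (Rabs _ * _))
    by (apply Rmult_le_pos; [apply Rabs_pos | apply pow_le; lra]).
  rewrite Rpow_mult_distr, Rabs_mult, (Rabs_pos_eq (r ^ j)) by (apply pow_le; lra).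
  rewrite <- Rmult_assoc. apply Rmult_le_compat_r; [apply pow_le; lra | apply HA].
Qed.

Lemma PSeries_0_r (A : nat -> R) : PSeries A 0 = A O.
Proof.
  apply is_series_unique. apply (is_pseries_R A 0 (A O)).
  pose proof (is_pseries_0 A) as H. exact H.
Qed.

Lemma binomial_series (s : R) (t : C) :
  Cmod t < 1 ->
  @is_series C_AbsRing C_NormedModule
    (fun j => (RtoC (binom_coef s j) * t ^ j)%C) (Cpower (1 - t) (RtoC s)).
Proof.
  intros Ht.
  set (A := fun j => binom_coef s j * Re (t ^ j)).
  set (B := fun j => binom_coef s j * Im (t ^ j)).
  assert (HRA : Rbar_lt 1 (CV_radius A)).
  { apply CV_radius_binom with s t; [exact Ht|]. intros j. unfold A.
    rewrite Rabs_mult, <- Cmod_pow. apply Rmult_le_compat_l; [apply Rabs_pos|].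
    apply re_le_Cmod. }
  assert (HRB : Rbar_lt 1 (CV_radius B)).
  { apply CV_radius_binom with s t; [exact Ht|]. intros j. unfold B.
    rewrite Rabs_mult, <- Cmod_pow. apply Rmult_le_compat_l; [apply Rabs_pos|].
    eapply Rle_trans; [|apply Rmax_Cmod]. apply Rmax_r. }
  assert (HA : forall u, 0 <= u <= 1 -> Rbar_lt (Rabs u) (CV_radius A)).
  { intros u Hu. eapply Rbar_le_lt_trans; [|exact HRA].
    simpl. rewrite Rabs_pos_eq; lra. }
  assert (HB : forall u, 0 <= u <= 1 -> Rbar_lt (Rabs u) (CV_radius B)).
  { intros u Hu. eapply Rbar_le_lt_trans; [|exact HRB].
    simpl. rewrite Rabs_pos_eq; lra. }
  assert (Hpow : forall j, Re (t ^ S j) = Re t * Re (t ^ j) - Im t * Im (t ^ j)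
                        /\ Im (t ^ S j) = Re t * Im (t ^ j) + Im t * Re (t ^ j)).
  { intros j. rewrite Cpow_S. split; reflexivity. }
  assert (HdA : forall j, PS_derive A j
            = (INR j - s) * (Re t * A j - Im t * B j)).
  { intros j. unfold PS_derive, A, B. rewrite <- Rmult_assoc, binom_coef_S.
    rewrite (proj1 (Hpow j)). ring. }
  assert (HdB : forall j, PS_derive B j
            = (INR j - s) * (Re t * B j + Im t * A j)).
  { intros j. unfold PS_derive, A, B. rewrite <- Rmult_assoc, binom_coef_S.
    rewrite (proj2 (Hpow j)). ring. }
  (* The Euler operator u d/du multiplies the coefficient of order j by j. *)
  assert (Heuler : forall D u, Rbar_lt (Rabs u) (CV_radius D) ->
            is_series (fun j => INR j * D j * u ^ j) (u * PSeries (PS_derive D) u)).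
  { intros D u Hu.
    apply (is_pseries_R (fun j => INR j * D j) u (u * PSeries (PS_derive D) u)).
    apply (is_pseries_ext (PS_incr_1 (PS_derive D))).
    - intros [|j]; simpl; [change zero with 0; ring | reflexivity].
    - apply (is_pseries_incr_1 (PS_derive D) u).
      apply PSeries_correct, CV_radius_inside. now rewrite CV_radius_derive. }
  assert (Hser : forall D u, Rbar_lt (Rabs u) (CV_radius D) ->
            is_series (fun j => D j * u ^ j) (PSeries D u)).
  { intros D u Hu. apply (is_pseries_R D u (PSeries D u)), PSeries_correct, CV_radius_inside, Hu. }
  assert (E : (PSeries A 1, PSeries B 1) = Cpower (1 - Re t, - Im t) (RtoC s)).
  { apply (Cpower_of_ode (Re t) (Im t) s (PSeries A) (PSeries B)
             (PSeries (PS_derive A)) (PSeries (PS_derive B))).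
    - rewrite <- Cmod2_alt. pose proof (Cmod_ge_0 t). nra.
    - rewrite PSeries_0_r. unfold A, binom_coef. simpl. rewrite pochhammer_0. field.
    - rewrite PSeries_0_r. unfold B. simpl. ring.
    - intros u Hu. now apply is_derive_PSeries, HA.
    - intros u Hu. now apply is_derive_PSeries, HB.
    - intros u Hu. apply is_series_unique.
      pose proof (Heuler A u (HA u Hu)) as EA. pose proof (Heuler B u (HB u Hu)) as EB.
      pose proof (Hser A u (HA u Hu)) as SA. pose proof (Hser B u (HB u Hu)) as SB.
      apply (is_series_scal (V := R_NormedModule) (Re t)) in EA.
      apply (is_series_scal (V := R_NormedModule) (- Im t)) in EB.
      apply (is_series_scal (V := R_NormedModule) (- s * Re t)) in SA.
      apply (is_series_scal (V := R_NormedModule) (s * Im t)) in SB.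
      pose proof (is_series_plus _ _ _ _ (is_series_plus _ _ _ _ EA EB)
                    (is_series_plus _ _ _ _ SA SB)) as H.
      match type of H with is_series _ ?l =>
        replace (u * (Re t * PSeries (PS_derive A) u - Im t * PSeries (PS_derive B) u)
                 - s * (Re t * PSeries A u - Im t * PSeries B u)) with l end.
      + revert H. apply is_series_ext. intros j.
        change (Re t * (INR j * A j * u ^ j) + - Im t * (INR j * B j * u ^ j)
                + (- s * Re t * (A j * u ^ j) + s * Im t * (B j * u ^ j))
                = PS_derive A j * u ^ j).
        rewrite HdA. ring.
      + change (Re t * (u * PSeries (PS_derive A) u)
                + - Im t * (u * PSeries (PS_derive B) u)
                + (- s * Re t * PSeries A u + s * Im t * PSeries B u)
                = u * (Re t * PSeries (PS_derive A) u - Im t * PSeries (PS_derive B) u)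
                 - s * (Re t * PSeries A u - Im t * PSeries B u)). ring.
    - intros u Hu. apply is_series_unique.
      pose proof (Heuler A u (HA u Hu)) as EA. pose proof (Heuler B u (HB u Hu)) as EB.
      pose proof (Hser A u (HA u Hu)) as SA. pose proof (Hser B u (HB u Hu)) as SB.
      apply (is_series_scal (V := R_NormedModule) (Im t)) in EA.
      apply (is_series_scal (V := R_NormedModule) (Re t)) in EB.
      apply (is_series_scal (V := R_NormedModule) (- s * Im t)) in SA.
      apply (is_series_scal (V := R_NormedModule) (- s * Re t)) in SB.
      pose proof (is_series_plus _ _ _ _ (is_series_plus _ _ _ _ EA EB)
                    (is_series_plus _ _ _ _ SA SB)) as H.
      match type of H with is_series _ ?l =>
        replace (u * (Re t * PSeries (PS_derive B) u + Im t * PSeries (PS_derive A) u)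
                 - s * (Re t * PSeries B u + Im t * PSeries A u)) with l end.
      + revert H. apply is_series_ext. intros j.
        change (Im t * (INR j * A j * u ^ j) + Re t * (INR j * B j * u ^ j)
                + (- s * Im t * (A j * u ^ j) + - s * Re t * (B j * u ^ j))
                = PS_derive B j * u ^ j).
        rewrite HdB. ring.
      + change (Im t * (u * PSeries (PS_derive A) u)
                + Re t * (u * PSeries (PS_derive B) u)
                + (- s * Im t * PSeries A u + - s * Re t * PSeries B u)
                = u * (Re t * PSeries (PS_derive B) u + Im t * PSeries (PS_derive A) u)
                 - s * (Re t * PSeries B u + Im t * PSeries A u)). ring. }
  replace (1 - t)%C with ((1 - Re t, - Im t) : C).
  2: { destruct t as [p q]. unfold Cminus, Cplus, Copp, RtoC. simpl. f_equal. ring. }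
  rewrite <- E. apply is_series_of_components.
  - change (is_series (fun j => Re (RtoC (binom_coef s j) * t ^ j)%C) (PSeries A 1)).
    apply (is_series_ext (fun j => A j * 1 ^ j)).
    + intros j. rewrite pow1, re_scal_l. apply Rmult_1_r.
    + apply Hser, HA. lra.
  - change (is_series (fun j => Im (RtoC (binom_coef s j) * t ^ j)%C) (PSeries B 1)).
    apply (is_series_ext (fun j => B j * 1 ^ j)).
    + intros j. rewrite pow1, im_scal_l. apply Rmult_1_r.
    + apply Hser, HB. lra.
Qed.

Lemma binomial_series_R (s x : R) :
  0 <= x < 1 -> is_series (fun j => binom_coef s j * x ^ j) (Rpower (1 - x) s).
Proof.
  intros Hx.
  assert (Ht : Cmod (RtoC x) < 1) by (rewrite Cmod_R, Rabs_pos_eq; lra).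
  pose proof (is_series_Re _ _ (binomial_series s (RtoC x) Ht)) as H.
  replace (1 - RtoC x)%C with ((1 - x, 0) : C) in H.
  2: { unfold Cminus, Cplus, Copp, RtoC. simpl. f_equal. ring. }
  rewrite Cpower_components in H by lra. cbn [Re fst] in H.
  replace (exp _ * cos _) with (Rpower (1 - x) s) in H.
  - revert H. apply is_series_ext. intros j. now rewrite re_scal_l, <- RtoC_pow, re_RtoC.
  - unfold Rdiv at 2. rewrite Rmult_0_l, atan_0, Rmult_0_r, cos_0, Rmult_1_r.
    unfold Rpower. do 2 f_equal.
    replace ((1 - x) ^ 2 + 0 ^ 2) with ((1 - x) * (1 - x)) by ring.
    rewrite ln_mult by lra. field.
Qed.

(** For [s <= 0] all the coefficients are nonnegative. *)
Lemma binomial_series_abs (s x : R) :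
  s <= 0 -> 0 <= x < 1 ->
  is_series (fun j => Rabs (binom_coef s j) * x ^ j) (Rpower (1 - x) s).
Proof.
  intros Hs Hx. apply (is_series_ext (fun j => binom_coef s j * x ^ j)).
  - intros j. rewrite Rabs_pos_eq; [reflexivity|]. unfold binom_coef.
    apply Rdiv_le_0_compat; [|apply INR_fact_lt_0].
    induction j as [|j IH]; [rewrite pochhammer_0; lra|].
    rewrite pochhammer_S. pose proof (pos_INR j). apply Rmult_le_pos; lra.
  - now apply binomial_series_R.
Qed.

(** * Growth of the Pochhammer factors *)

(** The [m] factors [1 - d, ..., m - d] are at most [m, ..., 1] in absolute
    value, and the remaining ones at most [1, ..., n - m]. *)
Lemma pochhammer_le_fact_mul_fact (d : R) (m n : nat) :
  INR m <= d <= INR m + 1 -> (m <= n)%nat ->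
  Rabs (pochhammer (1 - d) n) <= INR (fact m) * INR (fact (n - m)).
Proof.
  intros Hd Hn. induction Hn as [|n Hn IH].
  - rewrite Nat.sub_diag. simpl (INR (fact 0)). rewrite Rmult_1_r.
    revert d Hd. induction m as [|m IH]; intros d Hd.
    + rewrite pochhammer_0, Rabs_R1. simpl. lra.
    + rewrite pochhammer_S_l, Rabs_mult, fact_S_INR. rewrite S_INR in Hd.
      replace (1 - d + 1) with (1 - (d - 1)) by ring.
      pose proof (pos_INR m).
      apply Rmult_le_compat; try apply Rabs_pos.
      * apply Rabs_le. lra.
      * apply IH. lra.
  - rewrite pochhammer_S, Rabs_mult.
    replace (S n - m)%nat with (S (n - m)) by lia. rewrite fact_S_INR.
    assert (Hmn : INR m <= INR n) by (apply le_INR; lia).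
    rewrite minus_INR by lia.
    replace (INR (fact m) * ((INR n - INR m + 1) * INR (fact (n - m))))
      with (INR (fact m) * INR (fact (n - m)) * (INR n - INR m + 1)) by ring.
    apply Rmult_le_compat; try apply Rabs_pos; [exact IH|].
    apply Rabs_le. lra.
Qed.

(** Inverse of the probability of [m] successes in [n] trials of parameter [p]. *)
Definition inv_binomial_weight (p : R) (m n : nat) : R :=
  INR (fact m) * INR (fact (n - m)) / (INR (fact n) * (p ^ m * (1 - p) ^ (n - m))).

Lemma inv_binomial_weight_pos (p : R) (m n : nat) :
  0 < p < 1 -> 0 < inv_binomial_weight p m n.
Proof.
  intros Hp. pose proof INR_fact_lt_0 as Hf. unfold inv_binomial_weight.
  apply Rdiv_lt_0_compat; repeat apply Rmult_lt_0_compat; try apply Hf;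
    apply pow_lt; lra.
Qed.

Lemma inv_binomial_weight_up (p : R) (m n : nat) :
  0 < p < 1 -> (m <= n)%nat ->
  inv_binomial_weight p m (S n)
  = inv_binomial_weight p m n * ((INR (S n) - INR m) / (INR (S n) * (1 - p))).
Proof.
  intros Hp Hm. unfold inv_binomial_weight.
  replace (S n - m)%nat with (S (n - m)) by lia.
  rewrite !fact_S_INR, S_INR, minus_INR by lia.
  pose proof (pos_INR n). simpl pow. field.
  repeat split; try apply INR_fact_neq_0; try (apply pow_nonzero); lra.
Qed.

Lemma inv_binomial_weight_diag (p : R) (m n : nat) :
  0 < p < 1 -> (m <= n)%nat ->
  inv_binomial_weight p (S m) (S n)
  = inv_binomial_weight p m n * (INR (S m) / (INR (S n) * p)).
Proof.
  intros Hp Hm. unfold inv_binomial_weight.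
  replace (S n - S m)%nat with (n - m)%nat by lia.
  rewrite !fact_S_INR, !S_INR.
  pose proof (pos_INR n). simpl pow. field.
  repeat split; try apply INR_fact_neq_0; try (apply pow_nonzero); lra.
Qed.

(** From [n] to [n + 1] the integral part [m] either stays or increases by
    one; accordingly the ratio is [(n - m) / (n (1 - p))] or [m / (n p)] up to
    [O(1/n)], hence close to 1 because [m = n p + O(1)]. *)
Lemma inv_binomial_weight_ratio (p b : R) (m m' n : nat) :
  0 < p < 1 -> (m <= n)%nat ->
  INR m <= p * INR (S n) - b < INR m + 1 ->
  INR m' <= p * INR (S (S n)) - b < INR m' + 1 ->
  Rabs (inv_binomial_weight p m' (S n) / inv_binomial_weight p m n - 1)
  <= (Rabs b + 2) * (/ p + / (1 - p)) / INR (S n).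
Proof.
  intros Hp Hmn Hm Hm'.
  pose proof (inv_binomial_weight_pos p m n Hp) as Hw.
  assert (Hn : 0 < INR (S n)) by (apply lt_0_INR; lia).
  rewrite (S_INR (S n)) in Hm'.
  assert (Hi : 0 < / INR (S n)) by (now apply Rinv_0_lt_compat).
  assert (Hip : 0 < / p) by (apply Rinv_0_lt_compat; lra).
  assert (Hiq : 0 < / (1 - p)) by (apply Rinv_0_lt_compat; lra).
  pose proof (proj1 (Rabs_le_between b (Rabs b)) (Rle_refl _)) as Hb.
  assert (Hcases : m' = m \/ m' = S m).
  { assert (H1 : (m' < S (S m))%nat) by (apply INR_lt; rewrite !S_INR; lra).
    assert (H2 : (m < S m')%nat) by (apply INR_lt; rewrite !S_INR; lra). lia. }
  destruct Hcases as [-> | ->].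
  - rewrite inv_binomial_weight_up by assumption.
    replace (inv_binomial_weight p m n * ((INR (S n) - INR m) / (INR (S n) * (1 - p)))
             / inv_binomial_weight p m n - 1)
      with ((p * INR (S n) - INR m) * (/ (1 - p)) * / INR (S n)) by (field; lra).
    rewrite !Rabs_mult, (Rabs_pos_eq (/ INR (S n))), (Rabs_pos_eq (/ (1 - p))) by lra.
    apply Rmult_le_compat_r; [lra|].
    apply Rmult_le_compat; try lra; [apply Rabs_pos|]. apply Rabs_le. lra.
  - rewrite inv_binomial_weight_diag by assumption.
    replace (inv_binomial_weight p m n * (INR (S m) / (INR (S n) * p))
             / inv_binomial_weight p m n - 1)
      with ((INR (S m) - p * INR (S n)) * (/ p) * / INR (S n)) by (field; lra).
    rewrite !Rabs_mult, (Rabs_pos_eq (/ INR (S n))), (Rabs_pos_eq (/ p)) by lra.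
    apply Rmult_le_compat_r; [lra|]. rewrite S_INR.
    apply Rmult_le_compat; try lra; [apply Rabs_pos|]. apply Rabs_le. lra.
Qed.

(** Since [m - n p] is bounded, replacing [m] by [n p] in the exponents costs
    a constant factor. *)
Lemma binomial_term_rate (p b th : R) (m n : nat) :
  0 < p < 1 -> 0 < th -> (m <= n)%nat ->
  INR m <= p * INR (S n) - b < INR m + 1 ->
  p ^ m * (1 - p) ^ (n - m) * th ^ n
  <= exp ((Rabs b + 2) * Rabs (ln p - ln (1 - p)))
     * (th * (Rpower p p * Rpower (1 - p) (1 - p))) ^ n.
Proof.
  intros Hp Hth Hmn Hm.
  pose proof (proj1 (Rabs_le_between b (Rabs b)) (Rle_refl _)) as Hb.
  rewrite Rpow_mult_distr, (Rmult_comm (th ^ n)), <- Rmult_assoc.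
  apply Rmult_le_compat_r; [left; now apply pow_lt|].
  rewrite <- (Rpower_pow m p), <- (Rpower_pow (n - m)) by lra.
  rewrite <- Rpower_pow
    by (apply Rmult_lt_0_compat; apply exp_pos).
  unfold Rpower. rewrite ln_mult, !ln_exp by apply exp_pos.
  rewrite <- !exp_plus.
  set (D := ln p - ln (1 - p)).
  rewrite minus_INR by lia.
  replace (INR m * ln p + (INR n - INR m) * ln (1 - p))
    with ((INR m - p * INR n) * D + INR n * (p * ln p + (1 - p) * ln (1 - p)))
    by (unfold D; ring).
  assert (Hle : (INR m - p * INR n) * D <= (Rabs b + 2) * Rabs D).
  { eapply Rle_trans; [apply Rle_abs|]. rewrite Rabs_mult.
    apply Rmult_le_compat_r; [apply Rabs_pos|].
    rewrite S_INR in Hm. apply Rabs_le. lra. }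
  destruct (Rle_lt_or_eq_dec _ _ Hle) as [H|H].
  - left. apply exp_increasing. lra.
  - right. rewrite H. reflexivity.
Qed.

Lemma ex_series_inv_binomial_weight (p b ka : R) (m : nat -> nat) (N : nat) :
  0 < p < 1 -> 0 < ka < 1 ->
  (forall n, (N <= n)%nat -> (m n <= n)%nat) ->
  (forall n, (N <= n)%nat -> INR (m n) <= p * INR (S n) - b < INR (m n) + 1) ->
  ex_series (fun j => inv_binomial_weight p (m (N + j)%nat) (N + j) * ka ^ (N + j)).
Proof.
  intros Hp Hka Hmn Hm.
  set (w := fun j => inv_binomial_weight p (m (N + j)%nat) (N + j)).
  assert (Hw : forall j, 0 < w j) by (intros j; now apply inv_binomial_weight_pos).
  assert (Hpos : forall j, 0 < w j * ka ^ (N + j)).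
  { intros j. apply Rmult_lt_0_compat; [apply Hw | apply pow_lt; lra]. }
  apply (ex_series_ext (fun j => Rabs (w j * ka ^ (N + j)))).
  { intros j. apply Rabs_pos_eq. left. apply Hpos. }
  apply ex_series_DAlembert with ka; [lra | intros j; apply Rgt_not_eq, Hpos |].
  assert (Hr : is_lim_seq (fun j => w (S j) / w j) 1).
  { set (K := (Rabs b + 2) * (/ p + / (1 - p))).
    assert (HK : is_lim_seq (fun j => K / INR (S (N + j))) 0).
    { apply (is_lim_seq_ext (fun j => K / INR (S (j + N)))).
      - intros j. now rewrite Nat.add_comm.
      - apply (is_lim_seq_incr_n (fun j => K / INR (S j))). apply is_lim_seq_div_n. }
    apply (is_lim_seq_le_le (fun j => 1 - K / INR (S (N + j))) _
             (fun j => 1 + K / INR (S (N + j)))).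
    - intros j. unfold w. replace (N + S j)%nat with (S (N + j)) by lia.
      pose proof (inv_binomial_weight_ratio p b (m (N + j)%nat) (m (S (N + j))) (N + j)
                    Hp (Hmn (N + j)%nat ltac:(lia)) (Hm (N + j)%nat ltac:(lia))
                    (Hm (S (N + j)) ltac:(lia))) as H.
      fold K in H. apply Rabs_le_between in H. lra.
    - replace (Finite 1) with (Rbar_minus 1 0) by (simpl; f_equal; ring).
      apply is_lim_seq_minus'; [apply is_lim_seq_const | exact HK].
    - replace (Finite 1) with (Rbar_plus 1 0) by (simpl; f_equal; ring).
      apply is_lim_seq_plus'; [apply is_lim_seq_const | exact HK]. }
  apply (is_lim_seq_ext (fun j => ka * (w (S j) / w j))).
  - intros j. rewrite Rabs_pos_eq.
    + replace (N + S j)%nat with (S (N + j)) by lia. simpl pow. field.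
      pose proof (pow_lt ka (N + j) ltac:(lra)). specialize (Hw j). lra.
    + left. now apply Rdiv_lt_0_compat.
  - replace (Finite ka) with (Rbar_mult ka 1) by (simpl; f_equal; ring).
    now apply is_lim_seq_scal_l.
Qed.

(** The bound on [th] is the inverse of [p^p (1-p)^(1-p)] for [p = - c]. *)
Lemma ex_series_pochhammer (b c th : R) :
  -1 < c < 0 -> 0 <= th -> th < Rpower (Rabs c) c / Rpower (c + 1) (c + 1) ->
  ex_series (fun i => Rabs (pochhammer (1 + b + INR (S i) * c) i) / INR (fact i) * th ^ i).
Proof.
  intros Hc Hth0 Hth.
  set (p := - c). assert (Hp : 0 < p < 1) by (unfold p; lra).
  set (R0 := Rpower (Rabs c) c / Rpower (c + 1) (c + 1)) in *.
  assert (HR : R0 * (Rpower p p * Rpower (1 - p) (1 - p)) = 1).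
  { unfold R0. rewrite Rabs_left by lra. fold p.
    replace (1 - p) with (c + 1) by (unfold p; ring).
    replace c with (- p) at 1 by (unfold p; ring).
    rewrite Rpower_Ropp. unfold Rpower. field.
    split; apply Rgt_not_eq, exp_pos. }
  (* Enlarging th to om makes the ratio test available when th = 0 as well. *)
  set (om := (th + R0) / 2).
  assert (Hom : 0 < om < R0) by (unfold om; lra).
  set (P := Rpower p p * Rpower (1 - p) (1 - p)) in *.
  assert (HP : 0 < P) by (apply Rmult_lt_0_compat; apply exp_pos).
  set (ka := om * P).
  assert (Hka : 0 < ka < 1).
  { unfold ka. split; [now apply Rmult_lt_0_compat|]. rewrite <- HR.
    apply Rmult_lt_compat_r; lra. }
  set (d := fun n => p * INR (S n) - b).
  set (m := fun n => Z.to_nat (Int_part (d n))).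
  (* From this N on, 0 <= d n < n, so that m n is a valid lower index. *)
  destruct (INR_unbounded ((Rabs b + 2) * (/ p + / (1 - p)))) as [N HN].
  assert (Hbd : forall n, (N <= n)%nat -> 0 <= d n /\ d n < INR n).
  { intros n Hn. apply le_INR in Hn. unfold d. rewrite S_INR.
    pose proof (proj1 (Rabs_le_between b (Rabs b)) (Rle_refl _)) as Hb.
    assert (Hip : 0 < / p) by (apply Rinv_0_lt_compat; lra).
    assert (Hiq : 0 < / (1 - p)) by (apply Rinv_0_lt_compat; lra).
    assert (Hnb : (Rabs b + 2) * (/ p + / (1 - p)) < INR n) by lra.
    assert (H1 : Rabs b + 2 < p * INR n).
    { apply Rle_lt_trans with (p * ((Rabs b + 2) * (/ p + / (1 - p)))).
      - replace (p * ((Rabs b + 2) * (/ p + / (1 - p))))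
          with ((Rabs b + 2) * (1 + p * / (1 - p))) by (field; lra).
        assert (0 < p * / (1 - p)) by (apply Rmult_lt_0_compat; lra). nra.
      - apply Rmult_lt_compat_l; lra. }
    assert (H2 : Rabs b + 2 < (1 - p) * INR n).
    { apply Rle_lt_trans with ((1 - p) * ((Rabs b + 2) * (/ p + / (1 - p)))).
      - replace ((1 - p) * ((Rabs b + 2) * (/ p + / (1 - p))))
          with ((Rabs b + 2) * (1 + (1 - p) * / p)) by (field; lra).
        assert (0 < (1 - p) * / p) by (apply Rmult_lt_0_compat; lra). nra.
      - apply Rmult_lt_compat_l; lra. }
    lra. }
  assert (Hm : forall n, (N <= n)%nat -> INR (m n) <= d n < INR (m n) + 1).
  { intros n Hn. destruct (Hbd n Hn) as [H0 _]. unfold m.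
    destruct (base_Int_part (d n)) as [Hi1 Hi2].
    assert (H : (0 <= Int_part (d n))%Z).
    { apply Z.lt_succ_r. apply lt_IZR. rewrite succ_IZR. lra. }
    rewrite INR_IZR_INZ, Z2Nat.id by exact H. lra. }
  assert (Hmn : forall n, (N <= n)%nat -> (m n <= n)%nat).
  { intros n Hn. apply INR_le. destruct (Hbd n Hn). destruct (Hm n Hn). lra. }
  apply (ex_series_incr_n _ N).
  apply (ex_series_le (V := R_CompleteNormedModule) _ (fun j => exp ((Rabs b + 2) * Rabs (ln p - ln (1 - p)))
           * (inv_binomial_weight p (m (N + j)%nat) (N + j) * ka ^ (N + j)))).
  2: { apply (ex_series_scal (K := R_AbsRing) (V := R_NormedModule)).
       apply ex_series_inv_binomial_weight with b; try assumption. }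
  intros j. set (n := (N + j)%nat). assert (Hn : (N <= n)%nat) by (unfold n; lia).
  set (E := exp _).
  assert (Hf : 0 < INR (fact n)) by apply INR_fact_lt_0.
  change (Rabs (Rabs (pochhammer (1 + b + INR (S n) * c) n) / INR (fact n) * th ^ n)
          <= E * (inv_binomial_weight p (m n) n * ka ^ n)).
  rewrite Rabs_pos_eq.
  2: { apply Rmult_le_pos; [|now apply pow_le].
       apply Rdiv_le_0_compat; [apply Rabs_pos | exact Hf]. }
  replace (1 + b + INR (S n) * c) with (1 - d n) by (unfold d, p; ring).
  apply Rle_trans with (INR (fact (m n)) * INR (fact (n - m n)) / INR (fact n) * om ^ n).
  { apply Rmult_le_compat.
    - apply Rdiv_le_0_compat; [apply Rabs_pos | exact Hf].
    - now apply pow_le.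
    - apply Rmult_le_compat_r; [left; now apply Rinv_0_lt_compat|].
      destruct (Hm n Hn).
      apply pochhammer_le_fact_mul_fact; [lra | now apply Hmn].
    - apply pow_incr. unfold om. lra. }
  pose proof (binomial_term_rate p b om (m n) n Hp ltac:(lra) (Hmn n Hn) (Hm n Hn)) as HB.
  fold P in HB. fold ka in HB. fold E in HB.
  pose proof (inv_binomial_weight_pos p (m n) n Hp) as Hw.
  replace (INR (fact (m n)) * INR (fact (n - m n)) / INR (fact n) * om ^ n)
    with (inv_binomial_weight p (m n) n
          * (p ^ m n * (1 - p) ^ (n - m n) * om ^ n)).
  - replace (E * (inv_binomial_weight p (m n) n * ka ^ n))
      with (inv_binomial_weight p (m n) n * (E * ka ^ n)) by ring.
    apply Rmult_le_compat_l; lra.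
  - unfold inv_binomial_weight. field.
    repeat split; try apply INR_fact_neq_0; apply pow_nonzero; lra.
Qed.

(** * The double series *)

(** The real factor of the term [n = i + 1] of the right-hand series. *)
Definition rhs_coef (a b c : R) (i : nat) : R :=
  pochhammer (1 + b + INR (S i) * c) i / (INR (fact i) * (INR (S i) + a)).

(** For large [i] the exponent is nonpositive and the inner series is
    [(1 - x)^(b + (i+1) c)], which turns [x^(i+1)] into the power [th^(i+1)] of
    [th = x (1 - x)^c] up to the constant [(1 - x)^b]. *)
Lemma ex_series_dominant (a b c x : R) :
  -1 < c < 0 -> -1 < a -> 0 <= x < 1 ->
  x * Rpower (1 - x) c < Rpower (Rabs c) c / Rpower (c + 1) (c + 1) ->
  ex_series (fun i => Rabs (rhs_coef a b c i) * x ^ S i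
               * Series (fun j => Rabs (binom_coef (b + INR (S i) * c) j) * x ^ j)).
Proof.
  intros Hc Ha Hx Hth.
  set (th := x * Rpower (1 - x) c) in *.
  assert (Hth0 : 0 <= th) by (apply Rmult_le_pos; [lra | left; apply exp_pos]).
  destruct (INR_unbounded (b / - c)) as [N HN].
  apply (ex_series_incr_n _ N).
  set (K := th * Rpower (1 - x) b / (1 + a)).
  set (v := fun i => Rabs (pochhammer (1 + b + INR (S i) * c) i) / INR (fact i) * th ^ i).
  apply (ex_series_le (V := R_CompleteNormedModule) _ (fun j => K * v (N + j)%nat)).
  2: { apply (ex_series_scal (K := R_AbsRing) (V := R_NormedModule)).
       apply (ex_series_incr_n v N). now apply ex_series_pochhammer. }
  intros j. set (i := (N + j)%nat).
  assert (Hs : b + INR (S i) * c <= 0).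
  { assert (Hi : INR N <= INR i) by (apply le_INR; unfold i; lia).
    rewrite S_INR. assert (b / - c * - c = b) by (field; lra).
    assert (b / - c < INR i) by lra. nra. }
  rewrite (is_series_unique _ _ (binomial_series_abs _ _ Hs Hx)).
  set (y := Rpower (1 - x) (b + INR (S i) * c)).
  assert (Hy : x ^ S i * y = th * Rpower (1 - x) b * th ^ i).
  { unfold y. rewrite Rpower_plus, Rmult_comm with (r1 := INR (S i)), <- Rpower_mult.
    rewrite Rpower_pow by apply exp_pos.
    transitivity (Rpower (1 - x) b * th ^ S i); [|simpl; ring].
    unfold th. rewrite Rpow_mult_distr. ring. }
  change (Rabs (Rabs (rhs_coef a b c i) * x ^ S i * y) <= K * v i).
  rewrite Rabs_pos_eq.
  2: { apply Rmult_le_pos; [apply Rmult_le_pos|];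
         [apply Rabs_pos | apply pow_le; lra | left; apply exp_pos]. }
  rewrite Rmult_assoc, Hy. unfold K, v, rhs_coef.
  pose proof (pos_INR i) as Hi. pose proof (INR_fact_lt_0 i) as Hf.
  assert (Hia : 0 < INR (S i) + a) by (rewrite S_INR; lra).
  rewrite Rabs_div by (apply Rgt_not_eq; now apply Rmult_lt_0_compat).
  rewrite (Rabs_pos_eq (_ * _)) by (left; now apply Rmult_lt_0_compat).
  set (P := Rabs (pochhammer _ _)).
  assert (HP : 0 <= P) by apply Rabs_pos.
  set (Q := Rpower (1 - x) b). assert (HQ : 0 < Q) by apply exp_pos.
  assert (Hthi : 0 <= th ^ i) by now apply pow_le.
  assert (Hinv : / (INR (S i) + a) <= / (1 + a))
    by (apply Rinv_le_contravar; [lra | rewrite S_INR; lra]).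
  replace (P / (INR (fact i) * (INR (S i) + a)) * (th * Q * th ^ i))
    with (P / INR (fact i) * th * Q * th ^ i * / (INR (S i) + a)) by (field; lra).
  replace (th * Q / (1 + a) * (P / INR (fact i) * th ^ i))
    with (P / INR (fact i) * th * Q * th ^ i * / (1 + a)) by (field; lra).
  apply Rmult_le_compat_l; [|exact Hinv].
  clearbody th Q P. repeat apply Rmult_le_pos; try lra. left; now apply Rinv_0_lt_compat.
Qed.

Lemma sum_n_RtoC (u : nat -> R) (N : nat) :
  sum_n (fun n => RtoC (u n)) N = RtoC (sum_f_R0 u N).
Proof.
  rewrite <- sum_n_Reals. induction N as [|N IH]; [now rewrite !sum_O|].
  rewrite !sum_Sn, IH. symmetry. apply RtoC_plus.
Qed.

Theorem theorem4p2 (a b c : R) (t : C)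
    (hc : -1 < c < 0)
    (ha : -1 < a < 1)
    (ht1 : Cmod t < 1)
    (ht2 : Cmod t * Rpower (1 - Cmod t) c
           < Rpower (Rabs c) c / Rpower (c + 1) (c + 1)) :
  exists s : C,
    is_Cseries_from_1
      (fun n => t ^ n / RtoC (INR n + a)%R
                * RtoC (Rprod (fun k => (INR k - b + a * (c + 1)) / (INR k + a))%R
                              1 n))%C
      s /\
    is_Cseries_from_1
      (fun n => t ^ n * Cpower (1 - t) (RtoC (b + INR n * c)%R)
                * RtoC (pochhammer (1 + b + INR n * c) (n - 1)
                        / (INR (fact (n - 1)) * (INR n + a)))%R)%C
      s.
Proof.
  set (x := Cmod t) in *. assert (Hx : 0 <= x < 1) by (split; [apply Cmod_ge_0 | exact ht1]).
  set (s := fun i => b + INR (S i) * c).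
  set (f := fun i j => (RtoC (rhs_coef a b c i) * t ^ S i
                        * (RtoC (binom_coef (s i) j) * t ^ j))%C).
  set (A := fun i => (RtoC (rhs_coef a b c i) * t ^ S i
                      * Cpower (1 - t) (RtoC (s i)))%C).
  (* The i-th row of the triangle i + j <= N has N - i + 1 terms and converges
     to the i-th term A i of the right-hand series; summed by diagonals, the
     triangle is a partial sum of the left-hand series. *)
  destruct (tannery (K := C_AbsRing) (V := C_CompleteNormedModule)
              (fun i N => sum_n (f i) (N - i)) A
              (fun i => Rabs (rhs_coef a b c i) * x ^ S i
                 * Series (fun j => Rabs (binom_coef (s i) j) * x ^ j)))
    as [l [Hl1 Hl2]].
  - intros i N.
    assert (Hw : 0 <= Rabs (rhs_coef a b c i) * x ^ S i)
      by (apply Rmult_le_pos; [apply Rabs_pos | apply pow_le; lra]).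
    eapply Rle_trans;
      [exact (@norm_sum_n_m C_AbsRing C_NormedModule (f i) 0 (N - i))|].
    change (sum_n (fun j => Cmod (f i j)) (N - i)
            <= Rabs (rhs_coef a b c i) * x ^ S i
               * Series (fun j => Rabs (binom_coef (s i) j) * x ^ j)).
    rewrite (sum_n_ext _ (fun j => Rabs (rhs_coef a b c i) * x ^ S i
                                   * (Rabs (binom_coef (s i) j) * x ^ j))).
    2: { intros j. unfold f. now rewrite !Cmod_mult, !Cmod_R, !Cmod_pow. }
    rewrite (sum_n_mult_l (K := R_Ring)).
    apply Rmult_le_compat_l; [exact Hw|].
    rewrite sum_n_Reals. apply sum_incr.
    + apply is_lim_seq_Reals.
      eapply is_lim_seq_ext; [intros n; apply sum_n_Reals|].
      apply Series_correct, ex_series_binom_abs, Hx.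
    + intros j. apply Rmult_le_pos; [apply Rabs_pos | apply pow_le; lra].
  - intros i.
    apply (filterlim_comp _ _ _ (fun N => (N - i)%nat) (sum_n (f i))
             eventually eventually).
    + intros P [n0 Hn0]. exists (n0 + i)%nat. intros n Hn. apply Hn0. lia.
    + apply (is_series_scal (K := C_AbsRing) (V := C_NormedModule)
               (RtoC (rhs_coef a b c i) * t ^ S i)%C).
      now apply binomial_series.
  - apply ex_series_dominant; [exact hc | lra | exact Hx | exact ht2].
  - exists l. split.
    + unfold is_Cseries_from_1, is_series. eapply filterlim_ext; [|exact Hl2].
      intros N. cbv beta. rewrite sum_n_triangle. apply sum_n_ext. intros k.
      assert (Hk : INR (S k) + a <> 0).
      { rewrite S_INR. pose proof (pos_INR k). lra. }
      rewrite (sum_n_ext_loc _ (fun i => mult (t ^ S k)%C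
                 (RtoC (rhs_coef a b c i * binom_coef (s i) (k - i))))).
      * rewrite (sum_n_mult_l (K := C_Ring)), sum_n_RtoC.
        unfold rhs_coef, s. rewrite coefficient_identity by lra.
        rewrite RtoC_mult, RtoC_inv by exact Hk.
        unfold Cdiv. rewrite <- Cmult_assoc. reflexivity.
      * intros i Hi. unfold f.
        replace (S k) with (S i + (k - i))%nat by lia.
        rewrite Cpow_add_r, RtoC_mult. unfold mult; simpl. ring.
    + unfold is_Cseries_from_1. revert Hl1. apply is_series_ext. intros i.
      unfold A, rhs_coef, s. replace (S i - 1)%nat with i by lia.
      match goal with |- ?X = ?Y => change (X = Y :> C) end. ring.
Qed.
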